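(* Let $F$ be a field and let $\mathcal T_S$ be an arbitrary set of universal $\mathcal L$-sentences, where $\mathcal L$ is the language of rings with constant symbols for all elements of $F$ and a unary predicate symbol $\mathcal O$. Let $S(F;\mathcal T_S)$ be the set of all valuation rings $\mathcal O$ of $F$ such that $(F,\mathcal O)$ satisfies $\mathcal T_S$. Then $S(F;\mathcal T_S)$ together with the Zariski topology, given by the basic open sets $$\{\mathcal O\in S(F;\mathcal T_S)\mid a_1,\ldots,a_k\in\mathcal O\},\qquad k\ge0,\ a_1,\ldots,a_k\in F,$$ is a spectral space, and the topology given by the basic open sets $$\{\mathcal O\in S(F;\mathcal T_S)\mid a_1,\ldots,a_k\in\mathcal O;\ b_1,\ldots,b_\ell\in\mathcal M\},\qquad k,\ell\ge0,\ a_i,b_j\in F,$$ where $\mathcal M$ denotes the maximal ideal of $\mathcal O$, is its associated patch topology.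
   Context: $\mathcal L=\{+,-,\cdot,0,1\}\cup\mathcal F\cup\{\mathcal O\}$, where $\mathcal F$ is a set of constant symbols for all elements of $F$ and $\mathcal O$ is a unary predicate, interpreted by the valuation ring. Valuation rings of $F$ include the trivial one $\mathcal O=F$. A spectral space is in the sense of Hochster: a quasi-compact $T_0$ sober space whose quasi-compact open subsets form a basis closed under finite intersections. Its patch (constructible) topology is the topology generated by the quasi-compact open sets and their complements. *)

(* Defs.v *)
From HB Require Import structures.
From mathcomp Require Import all_boot all_order all_algebra.
From mathcomp Require Import all_classical.
From mathcomp Require Import topology_structure compact separation_axioms.

Set Implicit Arguments.
Unset Strict Implicit.
Unset Printing Implicit Defensive.

Import GRing.Theory.

Local Open Scope classical_set_scope.
Local Open Scope ring_scope.

Section Language.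
Variable F : Type.

(* The language of rings with a constant for each element of F and a unary
   predicate LO; variables are named by natural numbers. *)
Inductive lterm : Type :=
| LVar of nat
| LZero
| LOne
| LConst of F
| LAdd of lterm & lterm
| LSub of lterm & lterm
| LMul of lterm & lterm.

Inductive lformula : Type :=
| LFalse
| LEqual of lterm & lterm
| LO of lterm
| LNot of lformula
| LAnd of lformula & lformula
| LOr of lformula & lformula
| LImplies of lformula & lformula
| LExists of nat & lformula
| LForall of nat & lformula.

Fixpoint term_vars (t : lterm) : seq nat :=
  match t with
  | LVar i => [:: i]
  | LZero | LOne | LConst _ => [::]
  | LAdd t1 t2 | LSub t1 t2 | LMul t1 t2 => term_vars t1 ++ term_vars t2
  end.

Fixpoint free_vars (phi : lformula) : seq nat :=
  match phi with
  | LFalse => [::]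
  | LEqual t1 t2 => term_vars t1 ++ term_vars t2
  | LO t => term_vars t
  | LNot f => free_vars f
  | LAnd f1 f2 | LOr f1 f2 | LImplies f1 f2 => free_vars f1 ++ free_vars f2
  | LExists i f | LForall i f => [seq j <- free_vars f | j != i]
  end.

Fixpoint quantifier_free (phi : lformula) : bool :=
  match phi with
  | LFalse | LEqual _ _ | LO _ => true
  | LNot f => quantifier_free f
  | LAnd f1 f2 | LOr f1 f2 | LImplies f1 f2 =>
      quantifier_free f1 && quantifier_free f2
  | LExists _ _ | LForall _ _ => false
  end.

Definition universal_sentence (phi : lformula) : Prop :=
  free_vars phi = [::] /\
  exists (vs : seq nat) (psi : lformula),
    quantifier_free psi /\ phi = foldr LForall psi vs.

End Language.

Arguments LVar {F} _.
Arguments LZero {F}.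
Arguments LOne {F}.
Arguments LFalse {F}.

Section Semantics.
Variables (F : fieldType) (O : set F).

Fixpoint term_eval (e : nat -> F) (t : lterm F) : F :=
  match t with
  | LVar i => e i
  | LZero => 0
  | LOne => 1
  | LConst c => c
  | LAdd t1 t2 => term_eval e t1 + term_eval e t2
  | LSub t1 t2 => term_eval e t1 - term_eval e t2
  | LMul t1 t2 => term_eval e t1 * term_eval e t2
  end.

Fixpoint satisfies (e : nat -> F) (phi : lformula F) : Prop :=
  match phi with
  | LFalse => False
  | LEqual t1 t2 => term_eval e t1 = term_eval e t2
  | LO t => O (term_eval e t)
  | LNot f => ~ satisfies e f
  | LAnd f1 f2 => satisfies e f1 /\ satisfies e f2
  | LOr f1 f2 => satisfies e f1 \/ satisfies e f2
  | LImplies f1 f2 => satisfies e f1 -> satisfies e f2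
  | LExists i f => exists x : F, satisfies [eta e with i |-> x] f
  | LForall i f => forall x : F, satisfies [eta e with i |-> x] f
  end.

(* For a sentence the assignment [e] is immaterial. *)
Definition models (phi : lformula F) : Prop := forall e, satisfies e phi.

End Semantics.

Section ValuationRing.
Variable F : fieldType.
Implicit Types (O I M : set F).

Definition valuation_ring O : Prop :=
  GRing.subring_closed [in O] /\ forall x, x != 0 -> O x \/ O x^-1.

Definition ideal_of O I : Prop :=
  [/\ I `<=` O, I 0, (forall x y, I x -> I y -> I (x + y))
    & forall a x, O a -> I x -> I (a * x)].

Definition maximal_ideal_of O M : Prop :=
  [/\ ideal_of O M, M <> O
    & forall I, ideal_of O I -> M `<=` I -> I = M \/ I = O].

(* The maximal ideal of O; it exists and is unique when O is a valuation ring,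
   see [maximal_ideal_ofP]. *)
Definition maxideal O : set F := xget set0 (maximal_ideal_of O).

Lemma maximal_ideal_ofP O M : valuation_ring O ->
  maximal_ideal_of O M <-> M = [set x | O x /\ (x = 0 \/ ~ O x^-1)].
Proof.
move=> [[O1' OB' OM'] OV].
have O1 : O 1 by move: O1'; rewrite !inE.
have OB x y : O x -> O y -> O (x - y).
  by move=> Ox Oy; have := OB' x y; rewrite !inE; apply.
have OM x y : O x -> O y -> O (x * y).
  by move=> Ox Oy; have := OM' x y; rewrite !inE; apply.
have O0 : O 0 by rewrite -(subrr 1); exact: OB.
have OD x y : O x -> O y -> O (x + y).
  by move=> Ox Oy; rewrite -[y]opprK; apply: (OB) => //; rewrite -sub0r; exact: OB.
set N := [set x | _].
have mulN a x : O a -> N x -> N (a * x).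
  move=> Oa [Ox xN]; split; first exact: OM.
  have [->|a0] := eqVneq a 0; first by left; rewrite mul0r.
  case: xN => [->|xN]; first by left; rewrite mulr0.
  by right=> axV; apply: xN; rewrite -(mulKf a0 x) invfM invrK; apply: OM.
have addN' x y : x != 0 -> N x -> N y -> O (y / x) -> N (x + y).
  move=> x0 Nx _ Oyx; rewrite -[x in x + y]mul1r -[y](divfK x0) -mulrDl.
  by apply: mulN => //; exact: OD.
have idN : ideal_of O N.
  split=> [x [] // | | x y Nx Ny | //]; first by split=> //; left.
  have [->|x0] := eqVneq x 0; first by rewrite add0r.
  have [->|y0] := eqVneq y 0; first by rewrite addr0.
  have yx0 : y / x != 0 by rewrite mulf_neq0 ?invr_neq0.
  case: (OV _ yx0) => [|Oxy]; first exact: addN'.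
  by rewrite addrC; apply: addN' => //; rewrite invfM invrK mulrC in Oxy.
have N1 : ~ N 1 by move=> [_ [/eqP|]]; rewrite ?oner_eq0 ?invr1.
have full I : ideal_of O I -> I 1 -> I = O.
  move=> [IO _ _ IM] I1; apply/seteqP; split=> // x Ox.
  by rewrite -(mulr1 x); exact: IM.
have subN I : ideal_of O I -> I <> O -> I `<=` N.
  move=> idI nIO x Ix; have [IO _ _ IM] := idI; split; first exact: IO.
  have [->|x0] := eqVneq x 0; first by left.
  right=> OxV; apply/nIO/full => //; rewrite -(mulVf x0); exact: IM.
have nNO : N <> O by move=> NO; apply: N1; rewrite NO.
split=> [[idM nMO maxM]|->].
  by case: (maxM N idN (subN _ idM nMO)).
split=> // I idI NI; have [->|nIO] := pselect (I = O); first by right.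
by left; apply/seteqP; split=> //; exact: subN.
Qed.

Lemma maxidealE O : valuation_ring O ->
  maxideal O = [set x | O x /\ (x = 0 \/ ~ O x^-1)].
Proof.
move=> vO; apply/(maximal_ideal_ofP _ vO); rewrite /maxideal; apply: xgetPex.
by exists [set x | O x /\ (x = 0 \/ ~ O x^-1)]; apply/maximal_ideal_ofP.
Qed.

End ValuationRing.

Definition irreducible_set (X : topologicalType) (Z : set X) : Prop :=
  Z !=set0 /\
  forall A B : set X, closed A -> closed B -> Z `<=` A `|` B ->
    Z `<=` A \/ Z `<=` B.

Definition sober_space (X : topologicalType) : Prop :=
  forall Z : set X, closed Z -> irreducible_set Z ->
    exists! x : X, Z = closure [set x].

Definition compact_open (X : topologicalType) : set (set X) :=
  [set U | compact U /\ open U].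

(* The empty intersection is covered by the compactness of [set: X]. *)
Definition spectral_space (X : topologicalType) : Prop :=
  [/\ compact [set: X], kolmogorov_space X, sober_space X,
      basis (@compact_open X) & setI_closed (@compact_open X)].

(* An alias of X: the subbase of its topology is computed in X. *)
Definition patch_space (X : topologicalType) : Type := X.

HB.instance Definition _ (X : topologicalType) := Choice.on (patch_space X).
HB.instance Definition _ (X : topologicalType) :=
  @isSubBaseTopological.Build (patch_space X) (set X)
    [set U | compact_open U \/ compact_open (~` U)] id.

Lemma patch_space_openE (X : topologicalType) (U : set X) :
  @open (patch_space X) U <->
  exists2 D, D `<=` finI_from
               [set V : set X | compact_open V \/ compact_open (~` V)] id
    & \bigcup_(V in D) V = U.
Proof. by []. Qed.

Section ValuationSpace.
Variables (F : fieldType) (T : set (lformula F)).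

Definition valuation_rings : set (set F) :=
  [set O | valuation_ring O /\ forall phi, T phi -> models O phi].

Definition zariski_basic (s : seq F) : set valuation_rings :=
  [set O | forall a, a \in s -> val O a].

Definition zariski_patch_basic (s t : seq F) : set valuation_rings :=
  [set O | (forall a, a \in s -> val O a) /\
           (forall b, b \in t -> maxideal (val O) b)].

Definition zariski_space : Type := valuation_rings.

Definition zariski_patch_space : Type := valuation_rings.

Let zariski_cover : \bigcup_(U in range zariski_basic) id U = setT.
Proof. by apply/seteqP; split=> // O _; exists (zariski_basic [::]). Qed.

Let zariski_join (U V : set valuation_rings) O :
  range zariski_basic U -> range zariski_basic V -> id U O -> id V O ->
  exists W, [/\ range zariski_basic W, id W O & id W `<=` id U `&` id V].
Proof.
move=> [s _ <-] [s' _ <-] /= sO s'O; exists (zariski_basic (s ++ s')); split.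
- by exists (s ++ s').
- by move=> a; rewrite mem_cat => /orP[/sO|/s'O].
- by move=> P PO; split=> a sa; apply: PO; rewrite mem_cat sa ?orbT.
Qed.

HB.instance Definition _ := Choice.on zariski_space.
HB.instance Definition _ :=
  @isBaseTopological.Build zariski_space (set valuation_rings)
    (range zariski_basic) id zariski_cover zariski_join.

Let patch_cover :
  \bigcup_(U in range (uncurry zariski_patch_basic)) id U = setT.
Proof.
by apply/seteqP; split=> // O _; exists (zariski_patch_basic [::] [::]) => //;
  exists ([::], [::]).
Qed.

Let patch_join (U V : set valuation_rings) O :
  range (uncurry zariski_patch_basic) U ->
  range (uncurry zariski_patch_basic) V -> id U O -> id V O ->
  exists W, [/\ range (uncurry zariski_patch_basic) W, id W O
    & id W `<=` id U `&` id V].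
Proof.
move=> [[s t] _ <-] [[s' t'] _ <-] /= [sO tO] [s'O t'O].
exists (zariski_patch_basic (s ++ s') (t ++ t')); split.
- by exists (s ++ s', t ++ t').
- by split=> a; rewrite mem_cat => /orP[]; [exact: sO|exact: s'O|exact: tO|
    exact: t'O].
- by move=> P [sP tP]; split; split=> a sa; (apply: sP || apply: tP);
    rewrite mem_cat sa ?orbT.
Qed.

HB.instance Definition _ := Choice.on zariski_patch_space.
HB.instance Definition _ :=
  @isBaseTopological.Build zariski_patch_space (set valuation_rings)
    (range (uncurry zariski_patch_basic)) id patch_cover patch_join.

Lemma zariski_space_openE (U : set valuation_rings) :
  @open zariski_space U <->
  exists2 D, D `<=` range zariski_basic & \bigcup_(V in D) V = U.
Proof. by []. Qed.

Lemma zariski_patch_space_openE (U : set valuation_rings) :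
  @open zariski_patch_space U <->
  exists2 D, D `<=` range (uncurry zariski_patch_basic)
    & \bigcup_(V in D) V = U.
Proof. by []. Qed.

End ValuationSpace.

(* Main.v *)
Require Import Defs.
From mathcomp Require Import all_boot all_algebra.
From mathcomp Require Import all_classical.
From mathcomp Require Import topology_structure compact separation_axioms.

(** Everything rests on limits along ultrafilters. Given an ultrafilter [U] on
    [S(F; T)], the elements of [F] lying in [U]-almost every valuation ring
    form a set [O_U]; it is what the ultraproduct of the structures
    [(F, O)] cuts out on the diagonal copy of [F]. It is again a valuation ring
    ([valuation_ring_ultralimit]), and by the theorem of Los for quantifier-free
    formulas ([satisfies_ultralimit]) it satisfies every universal sentence which
    holds in all the [O]: this is where universality is needed, since the
    diagonal is only a substructure of the ultraproduct. So each ultrafilter has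
    a limit [O_U] in [S(F; T)].

    The ultrafilter [U] converges to [O_U] for the Zariski topology, [O_U] is
    the largest of its Zariski limits ([cvg_ultralimit], [zariski_cvg_le]), and
    for the finer topology it is the only limit ([patch_cvg_ultralimit]). Hence
    membership in a compact open set is detected at the limit: [U A] holds iff
    [A] contains [O_U] ([compact_open_ultralimit]).

    All claims follow. The basic open sets are compact because the conditions
    that define them pass to [O_U]. An intersection of two compact open sets
    again contains the limits of its ultrafilters, so it is compact. If [Z] is
    closed and irreducible, the basic open sets that meet [Z] generate with [Z]
    a proper filter; the limit of an ultrafilter above it is the largest element
    of [Z], that is, its generic point. Finally a compact open set and its
    complement are open for the topology of the conditions [a \in O] and
    [b \in M], because each of them contains every ultrafilter whose limit it
    contains, and limits are unique ([patch_open_ultralimit]). Conversely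
    [b \in M] means [b = 0] or [b^-1 \notin O], and the latter is the complement
    of a basic open set. *)

Set Implicit Arguments.
Unset Strict Implicit.
Unset Printing Implicit Defensive.

Import GRing.Theory.

Local Open Scope classical_set_scope.
Local Open Scope ring_scope.

(** * Ultrafilters *)

Lemma ultra_setC (I : Type) (U : set_system I) (A : set I) :
  UltraFilter U -> U (~` A) <-> ~ U A.
Proof.
move=> UU; split=> [UnA UA|nUA].
  by have [x []] := filter_ex (filterI UA UnA).
by have [] := in_ultra_setVsetC A UU.
Qed.

Lemma ultra_imply (I : Type) (U : set_system I) (A B : set I) :
  UltraFilter U -> U [set i | A i -> B i] <-> (U A -> U B).
Proof.
move=> UU; split=> [UAB UA|UAB].
  by apply: filterS (filterI UAB UA) => i [AB /AB].
have [/UAB|] := in_ultra_setVsetC A UU; first by apply: filterS => i /=.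
by apply: filterS => i nA /nA.
Qed.

(** * Limits of valuation rings along an ultrafilter *)

Section UltraLimitRing.
Variables (F : fieldType) (I : Type) (Os : I -> set F) (U : set_system I).
Hypothesis UU : UltraFilter U.

Definition ultralimit_ring : set F := [set a | U [set i | Os i a]].

(** The theorem of Los for the diagonal copy of [F] in the ultraproduct; it is
    restricted to quantifier-free formulas as the diagonal is a substructure,
    not an elementary one. *)
Lemma satisfies_ultralimit (psi : lformula F) (e : nat -> F) :
  quantifier_free psi ->
  satisfies ultralimit_ring e psi <-> U [set i | satisfies (Os i) e psi].
Proof.
elim: psi => //=.
- by move=> _; split=> // /filter_ex[].
- by move=> t1 t2 _; split=> [t12|/filter_ex[]//]; apply: filterE.
- by move=> f IHf /IHf->; rewrite -ultra_setC.
- move=> f IHf g IHg /andP[/IHf-> /IHg->].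
  split=> [[Uf Ug]|Ufg]; first exact: filterI.
  by split; apply: filterS Ufg => i [].
- move=> f IHf g IHg /andP[/IHf-> /IHg->].
  split=> [[]|Ufg]; [by apply: filterS; left|by apply: filterS; right|].
  have [Uf|] := in_ultra_setVsetC [set i | satisfies (Os i) e f] UU.
    by left.
  by move=> Unf; right; apply: filterS (filterI Ufg Unf) => i [[]].
- by move=> f IHf g IHg /andP[/IHf-> /IHg->]; rewrite ultra_imply.
Qed.

(** The quantifiers range over the same field [F] for all the rings, so the matrix
    can be transferred for one assignment of the variables at a time. *)
Lemma universal_ultralimit (phi : lformula F) : universal_sentence phi ->
  (forall i, models (Os i) phi) -> models ultralimit_ring phi.
Proof.
move=> [_ [vs [psi [qf ->]]]] Ophi e.
have {Ophi} : forall i, satisfies (Os i) e (foldr (@LForall F) psi vs).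
  by move=> i; exact: Ophi.
elim: vs e => [|v vs IH] e /= Ophi.
  by apply/satisfies_ultralimit => //; exact: filterE.
by move=> x; apply: IH => i; exact: Ophi.
Qed.

Lemma valuation_ring_ultralimit :
  (forall i, valuation_ring (Os i)) -> valuation_ring ultralimit_ring.
Proof.
move=> vO; split; last first.
  move=> x x0; have [|] := in_ultra_setVsetC [set i | Os i x] UU; first by left.
  by right; apply: filterS b => i /= nx; have [_ /(_ x x0)[]] := vO i.
split; rewrite ?inE.
- by apply: filterE => i; have [[+ _ _] _] := vO i; rewrite inE.
- move=> x y; rewrite !inE => Ux Uy; apply: filterS (filterI Ux Uy) => i [].
  by have [[_ + _] _] := vO i => /(_ x y); rewrite !inE => H /H; exact.
- move=> x y; rewrite !inE => Ux Uy; apply: filterS (filterI Ux Uy) => i [].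
  by have [[_ _ +] _] := vO i => /(_ x y); rewrite !inE => H /H; exact.
Qed.

End UltraLimitRing.

(** * Basic neighbourhoods *)

Lemma patch_space_subbase_open (X : topologicalType) (A : set X) :
  compact_open A \/ compact_open (~` A) -> @open (patch_space X) A.
Proof.
move=> cA; exists [set A]; last by rewrite bigcup_set1.
by move=> _ ->; exact: finI_from1.
Qed.

Section ValuationSpace.
Variables (F : fieldType) (T : set (lformula F)).
Hypothesis univT : forall phi, T phi -> universal_sentence phi.

Local Notation X := (valuation_rings T).
Local Notation ZX := (zariski_space T).
Local Notation PX := (zariski_patch_space T).

Implicit Types (O P : X) (A Z : set X).

Lemma valuation_ringP O : valuation_ring (val O).
Proof. by have /set_mem[] := valP O. Qed.

Lemma maxideal_inv O b : b != 0 ->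
  maxideal (val O) b <-> ~ val O b^-1.
Proof.
move=> b0; rewrite maxidealE; last exact: valuation_ringP.
split=> [[_ [/eqP|//]]|nOb]; first by rewrite (negPf b0).
by split; [have [_ /(_ b b0)[]] := valuation_ringP O|right].
Qed.

Lemma valuation_ring0 O : val O 0.
Proof.
have [[O1 OB _] _] := valuation_ringP O.
by have := OB 1 1 O1 O1; rewrite subrr inE.
Qed.

Lemma maxideal0 O : maxideal (val O) 0.
Proof.
rewrite maxidealE; last exact: valuation_ringP.
by split; [exact: valuation_ring0|left].
Qed.

Lemma zariski_nbhsP O A : nbhs (O : ZX) A <->
  exists2 s, zariski_basic s O & zariski_basic s `<=` A.
Proof.
rewrite nbhsE; split=> [[B [[D sD <-] [V DV VO]] BA]|[s sO sA]].
  have [s _ sV] := sD _ DV; exists s; first by rewrite sV.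
  by move=> P; rewrite sV => VP; apply: BA; exists V.
exists (zariski_basic s) => //; split=> //.
by exists [set zariski_basic s]; [move=> _ ->; exists s|rewrite bigcup_set1].
Qed.

Lemma patch_nbhsP O A : nbhs (O : PX) A <->
  exists s t, zariski_patch_basic s t O /\ zariski_patch_basic s t `<=` A.
Proof.
rewrite nbhsE; split=> [[B [[D sD <-] [V DV VO]] BA]|[s [t [sO sA]]]].
  have [[s t] _ /= sV] := sD _ DV; exists s, t; rewrite sV; split=> //.
  by move=> P VP; apply: BA; exists V.
exists (zariski_patch_basic s t) => //; split=> //.
exists [set zariski_patch_basic s t]; last by rewrite bigcup_set1.
by move=> _ ->; exists (s, t).
Qed.

Lemma zariski_basic_open s : @open ZX (zariski_basic s).
Proof. by rewrite openE => O sO; apply/zariski_nbhsP; exists s. Qed.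

(** * Convergence of ultrafilters *)

Section UltraLimit.
Variable U : set_system X.
Hypothesis UU : UltraFilter U.

Lemma ultralimit_subproof : X (ultralimit_ring val U).
Proof.
split; first by apply: valuation_ring_ultralimit => O; exact: valuation_ringP.
move=> phi Tphi; apply: universal_ultralimit => [|O]; first exact: univT.
by have /set_mem[_] := valP O; exact.
Qed.

Definition ultralimit : X := SigSub (mem_set ultralimit_subproof).

Lemma zariski_basic_ultralimit s :
  U (zariski_basic s) <-> zariski_basic s ultralimit.
Proof.
split=> [Us a sa|]; first by apply: filterS Us => O; exact.
elim: s => [|a s IH] sO; first exact: filterE.
have Ua : U [set O | val O a] by apply: sO; rewrite mem_head.
have Us : U (zariski_basic s).
  by apply: IH => b sb; apply: sO; rewrite in_cons sb orbT.
apply: filterS (filterI Ua Us) => O [Oa Os] b.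
by rewrite in_cons => /predU1P[->|/Os].
Qed.

Lemma cvg_ultralimit : U --> (ultralimit : ZX).
Proof.
move=> A /zariski_nbhsP[s /zariski_basic_ultralimit Us sA].
exact: filterS Us.
Qed.

(** The condition [a \in O] is open, so it holds [U]-almost everywhere as soon
    as it holds at one limit of [U]. *)
Lemma zariski_cvg_le (O : ZX) : U --> O -> val O `<=` val ultralimit.
Proof.
move=> UO a Oa; apply/UO/zariski_nbhsP.
by exists [:: a] => [b|P]; [rewrite inE => /eqP->|apply; rewrite mem_head].
Qed.

(** Limits are unique here because [a \notin O] is an open condition too: for
    [a != 0] it says that [a^-1] lies in the maximal ideal. *)
Lemma patch_cvg_ultralimit (O : PX) : U --> O -> O = ultralimit.
Proof.
move=> UO; apply/val_inj/seteqP; split.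
  apply: zariski_cvg_le => A /zariski_nbhsP[s sO sA].
  apply/UO/patch_nbhsP; exists s, [::]; split=> // P [sP _]; exact: sA.
move=> a Ua; apply: contrapT => nOa.
have a0 : a != 0 by apply: contra_not_neq nOa => ->; exact: valuation_ring0.
have : U (~` [set P | val P a]); last by move/ultra_setC.
apply/UO/patch_nbhsP; exists [::], [:: a^-1]; split.
  by split=> // b; rewrite inE => /eqP->; apply/maxideal_inv;
    rewrite ?invr_eq0 // invrK.
move=> P [_ /(_ _ (mem_head _ _))] /maxideal_inv.
by rewrite invr_eq0 invrK => /(_ a0).
Qed.

(** Compactness of [A] only provides some Zariski limit in [A]; since [A] is
    open, it also contains every larger valuation ring. *)
Lemma compact_open_ultralimit A :
  @compact_open ZX A -> U A <-> A ultralimit.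
Proof.
move=> [cA oA]; split=> [UA|AU]; last first.
  by apply/cvg_ultralimit/open_nbhs_nbhs.
move: cA; rewrite compact_ultra => /(_ _ UU UA)[O [AO /= UO]].
have /zariski_nbhsP[s sO sA] : nbhs (O : ZX) A by apply: open_nbhs_nbhs.
by apply: sA => a sa; apply: (zariski_cvg_le UO); exact: sO.
Qed.

End UltraLimit.

(** * The Zariski topology is spectral *)

Lemma compact_ultralimit A :
  (forall U (UU : UltraFilter U), U A -> A (ultralimit UU)) -> @compact ZX A.
Proof.
move=> limA; rewrite compact_ultra => U UU UA.
by exists (ultralimit UU); split; [exact: limA|exact: cvg_ultralimit].
Qed.

Lemma zariski_basic_compact_open s : @compact_open ZX (zariski_basic s).
Proof.
split; last exact: zariski_basic_open.
by apply: compact_ultralimit => U UU /zariski_basic_ultralimit.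
Qed.

(** The specialization order is inclusion: generic points are the largest
    valuation rings. *)
Lemma closure_zariski_set1 O : @closure ZX [set O] = [set P | val P `<=` val O].
Proof.
apply/seteqP; split=> P /= PO.
  move=> a Pa; have /PO[_ [->]] : nbhs (P : ZX) (zariski_basic [:: a]).
    by apply/zariski_nbhsP; exists [:: a] => // b; rewrite inE => /eqP->.
  by apply; rewrite mem_head.
move=> A /zariski_nbhsP[s sP sA]; exists O; split=> //.
by apply: sA => a /sP/PO.
Qed.

Lemma zariski_kolmogorov : kolmogorov_space ZX.
Proof.
move=> O P OP.
have sep (Q R : X) : ~ val Q `<=` val R ->
    exists A, A \in nbhs (Q : ZX) /\ R \in ~` A.
  move=> /existsNP[a /not_implyP[Qa nRa]]; exists (zariski_basic [:: a]).
  split; rewrite inE; last by move=> /(_ _ (mem_head _ _)).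
  by apply/zariski_nbhsP; exists [:: a] => // b; rewrite inE => /eqP->.
have [sOP|/sep[A ?]] := pselect (val O `<=` val P); last by exists A; left.
have [sPO|/sep[A ?]] := pselect (val P `<=` val O); last by exists A; right.
by case/eqP: OP; apply/val_inj/seteqP.
Qed.

(** By irreducibility, the conditions [a \in O] that hold somewhere on [Z] are
    finitely satisfiable together on [Z]; a limit then satisfies all of them. *)
Lemma zariski_irreducible_max Z : @closed ZX Z -> @irreducible_set ZX Z ->
  exists2 O, Z O & forall P, Z P -> val P `<=` val O.
Proof.
move=> cZ [[O0 ZO0] irrZ].
pose G := filter_from [set s | Z `&` zariski_basic s !=set0]
            (fun s => Z `&` zariski_basic s).
have GP : ProperFilter G.
  apply: filter_from_proper => [|s //]; apply: filter_from_filter.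
    by exists [::], O0.
  move=> s t Zs Zt; exists (s ++ t) => [|O [ZO stO]]; last first.
    by split; split=> // a sa; apply: stO; rewrite mem_cat sa ?orbT.
  (* If this failed, [Z] would be covered by the two complements. *)
  apply: contrapT => Zst.
  have [|||Zns|Znt] := irrZ (~` zariski_basic s) (~` zariski_basic t).
  - exact/open_closedC/zariski_basic_open.
  - exact/open_closedC/zariski_basic_open.
  - move=> O ZO; apply: contrapT => /not_orP[/contrapT sO /contrapT tO].
    by apply: Zst; exists O; split=> // a; rewrite mem_cat => /orP[/sO|/tO].
  - by have [O [ZO sO]] := Zs; case: (Zns O ZO).
  - by have [O [ZO tO]] := Zt; case: (Znt O ZO).
have [U [UU GU]] := ultraFilterLemma GP; exists (ultralimit UU).
  apply: cZ => A /cvg_ultralimit UA.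
  have UZ : U Z.
    by apply: GU; exists [::]; [exists O0|move=> ? []].
  exact: filter_ex (filterI UZ UA).
move=> P ZP a Pa; apply: GU; exists [:: a].
  by exists P; split=> // b; rewrite inE => /eqP->.
by move=> O [_ /(_ _ (mem_head _ _))].
Qed.

Lemma zariski_sober : sober_space ZX.
Proof.
move=> Z cZ irrZ; have [O ZO Omax] := zariski_irreducible_max cZ irrZ.
exists O; split=> [|P].
  apply/seteqP; split=> [P /Omax|P]; rewrite closure_zariski_set1 //.
  move=> PO; apply: cZ => A /zariski_nbhsP[s sP sA]; exists O; split=> //.
  by apply: sA => a /sP/PO.
rewrite closure_zariski_set1 => ZE; apply/val_inj/seteqP; split.
  by move: ZO; rewrite ZE.
by apply: Omax; rewrite ZE.
Qed.

Lemma zariski_spectral : spectral_space ZX.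
Proof.
split.
- by apply: compact_ultralimit.
- exact: zariski_kolmogorov.
- exact: zariski_sober.
- split=> [A []//|O A /zariski_nbhsP[s sO sA]].
  exists (zariski_basic s) => //; split=> //.
  exact: zariski_basic_compact_open.
- move=> A B cA cB; split; last by apply: openI; [case: cA|case: cB].
  apply: compact_ultralimit => U UU UAB.
  by split; apply/compact_open_ultralimit => //; apply: filterS UAB => O [].
Qed.

(** * Comparison with the patch topology *)

(** If [A] is not a neighbourhood of [O], the neighbourhoods of [O] all meet the
    complement of [A], so some ultrafilter containing that complement converges
    to [O]. *)
Lemma patch_open_ultralimit A :
  (forall U (UU : UltraFilter U), A (ultralimit UU) -> U A) -> @open PX A.
Proof.
move=> limA; rewrite openE => O AO; apply: contrapT => nOA.
have WP : ProperFilter (within (~` A) (nbhs (O : PX))).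
  apply: Build_ProperFilter => W0; apply: nOA.
  rewrite /interior; apply: (@filterS PX _ _ [set P | ~ A P -> False]) W0.
  by move=> P /contrapT.
have [U [UU WU]] := ultraFilterLemma WP.
have OU : O = ultralimit UU.
  by apply: patch_cvg_ultralimit => B OB; apply: WU; apply: filterS OB.
have /limA : A (ultralimit UU) by rewrite -OU.
by apply/ultra_setC/WU; exact: withinT.
Qed.

Lemma compact_open_patch_open A :
  @compact_open ZX A -> @open PX A /\ @open PX (~` A).
Proof.
move=> cA; split; apply: patch_open_ultralimit => U UU.
  by move=> AU; apply/(compact_open_ultralimit UU cA).
move=> /= nA; apply/ultra_setC => UA.
exact/nA/(compact_open_ultralimit UU cA).
Qed.

(** For [b != 0] the set is the complement of a basic open set; for [b = 0] it
    is the whole space, which is compact. *)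
Lemma maxideal_patch_open b :
  @open (patch_space ZX) [set O | maxideal (val O) b].
Proof.
apply: patch_space_subbase_open; have [->|b0] := eqVneq b 0.
  left; rewrite (_ : [set _ | _] = zariski_basic [::]).
    exact: zariski_basic_compact_open.
  by apply/seteqP; split=> // O _; exact: maxideal0.
right; rewrite (_ : ~` _ = zariski_basic [:: b^-1]).
  exact: zariski_basic_compact_open.
apply/seteqP; split=> O /=.
  by move/maxideal_inv => /(_ b0)/contrapT Ob c; rewrite inE => /eqP->.
by move=> /(_ _ (mem_head _ _)) Ob /maxideal_inv; exact.
Qed.

Lemma patch_basic_open s t :
  @open (patch_space ZX) (zariski_patch_basic s t).
Proof.
rewrite (_ : zariski_patch_basic s t = zariski_basic s `&`
  \bigcap_(b in [set` t]) [set O | maxideal (val O) b]); last first.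
  by apply/seteqP; split=> O [].
apply: openI.
  by apply: patch_space_subbase_open; left; exact: zariski_basic_compact_open.
rewrite bigcap_seq; apply: (big_ind (@open (patch_space ZX))) => [||b _].
- exact: openT.
- exact: openI.
- exact: maxideal_patch_open.
Qed.

Lemma open_zariski_patchE A : @open PX A <-> @open (patch_space ZX) A.
Proof.
split=> [[D sD <-]|[D sD <-]]; apply: bigcup_open => V /sD.
  by move=> [[s t] _ <-]; exact: patch_basic_open.
move=> [E sE <-]; rewrite bigcap_fset big_seq.
apply: (big_ind (@open PX)) => [||B /sE]; [exact: openT|exact: openI|].
rewrite inE => -[/compact_open_patch_open[] //|/compact_open_patch_open[_]].
by rewrite setCK.
Qed.

End ValuationSpace.

Theorem theorem41 (F : fieldType) (T_S : set (lformula F))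
  (hT_S : forall phi, T_S phi -> universal_sentence phi) :
  spectral_space (zariski_space T_S) /\
  forall U : set (valuation_rings T_S),
    @open (zariski_patch_space T_S) U <->
    @open (patch_space (zariski_space T_S)) U.
Proof.
split; first exact: zariski_spectral.
by move=> U; exact: open_zariski_patchE.
Qed.
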